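(* For any involutory quandle $X$ there is a functor $$\mathrm{Col}_X:\mathbf{KDiag}\to\mathbf{Set}$$ which associates to any unoriented link diagram $K$ the set of $X$-colorings of $K$.
   Context: A quandle is a set $Q$ with two binary operations $\triangleright,\triangleleft$ such that for all $a,b,c\in Q$: (Q1) $a\triangleright a=a$; (Q2) $(b\triangleright a)\triangleleft b=a=b\triangleright(a\triangleleft b)$; (Q3) $a\triangleright(b\triangleright c)=(a\triangleright b)\triangleright(a\triangleright c)$. It is involutory if moreover $b\triangleright a=a\triangleleft b$ for all $a,b$. An arc of an unoriented link diagram is a maximal piece of the diagram running from one undercrossing to the next (a closed component with no undercrossings counts as one arc). An $X$-coloring of a diagram, for an involutory quandle $X$, is an assignment of an element of $X$ to each arc such that at each crossing with over-arc colored $b$ and one under-arc colored $a$, the other under-arc is colored $b\triangleright a$ (because $X$ is involutory, it does not matter which under-arc is called the first). $\mathbf{KDiag}$ is the groupoid whose objects are unoriented link diagrams and whose morphisms are sequences of Reidemeister moves transforming the source diagram into the target diagram, composed by concatenation, the reversed move being the inverse of a move. $\mathbf{Set}$ is the category of sets and functions. *)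

(* Defs.v *)
From mathcomp Require Import all_boot all_order all_algebra.
From mathcomp Require Import all_classical all_reals all_analysis.
From Stdlib Require Import Relation_Operators RelationClasses.

Set Implicit Arguments.
Unset Strict Implicit.
Unset Printing Implicit Defensive.

Import Order.TTheory GRing.Theory Num.Theory.
Import numFieldNormedType.Exports.

Local Open Scope classical_set_scope.
Local Open Scope ring_scope.

(** * Quandles *)

Record quandle := Quandle {
  qcarrier :> Type;
  rtri : qcarrier -> qcarrier -> qcarrier;
  ltri : qcarrier -> qcarrier -> qcarrier;
  rtri_idem : forall a, rtri a a = a;
  rtriK : forall a b, ltri (rtri b a) b = a;
  ltriK : forall a b, rtri b (ltri a b) = a;
  rtri_distr : forall a b c, rtri a (rtri b c) = rtri (rtri a b) (rtri a c)
}.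

Declare Scope quandle_scope.
Delimit Scope quandle_scope with quandle.
Notation "a ▷ b" := (rtri a b) (at level 40, left associativity) : quandle_scope.
Notation "a ◁ b" := (ltri a b) (at level 40, left associativity) : quandle_scope.

Definition involutory (X : quandle) : Prop :=
  forall a b : X, (b ▷ a = a ◁ b)%quandle.

(** * Categories

    Equality of morphisms is an equivalence relation [heq], so that a groupoid
    presented by generators and relations needs no quotient type. *)

Record category := Category {
  obj :> Type;
  hom : obj -> obj -> Type;
  heq : forall A B, hom A B -> hom A B -> Prop;
  idc : forall A, hom A A;
  comp : forall A B C, hom A B -> hom B C -> hom A C;
  heq_equiv : forall A B, Equivalence (@heq A B);
  comp_heq : forall A B C (f f' : hom A B) (g g' : hom B C),
    heq f f' -> heq g g' -> heq (comp f g) (comp f' g');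
  comp_idl : forall A B (f : hom A B), heq (comp (idc A) f) f;
  comp_idr : forall A B (f : hom A B), heq (comp f (idc B)) f;
  compA : forall A B C D (f : hom A B) (g : hom B C) (h : hom C D),
    heq (comp f (comp g h)) (comp (comp f g) h)
}.

Definition is_groupoid (C : category) : Prop :=
  forall (A B : C) (f : hom A B), exists g : hom B A,
    heq (comp f g) (idc A) /\ heq (comp g f) (idc B).

Record functor (C D : category) := Functor {
  fobj :> C -> D;
  fhom : forall A B : C, hom A B -> hom (fobj A) (fobj B);
  fhom_heq : forall (A B : C) (f g : hom A B),
    heq f g -> heq (fhom f) (fhom g);
  fhom_id : forall A : C, heq (fhom (idc A)) (idc (fobj A));
  fhom_comp : forall (A B E : C) (f : hom A B) (g : hom B E),
    heq (fhom (comp f g)) (comp (fhom f) (fhom g))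
}.

Definition SetCat : category.
Proof.
refine (@Category Type (fun A B => A -> B) (fun A B f g => f = g)
  (fun A x => x) (fun A B C f g x => g (f x)) _ _ _ _ _) => //.
by move=> A B C f f' g g' -> ->.
Defined.

(** * Link diagrams

    Link diagrams are polygonal diagrams in the plane R^2.  The vertices are
    the crossings together with the corners of the polygons (a vertex of
    valency 2 may be flat); the edges are the straight segments between
    consecutive vertices. *)

Section Diagrams.
Variable R : realType.

Local Notation plane := (R * R)%type.

Definition open_segment (u v : plane) : set plane :=
  [set w | exists t : R, [/\ 0 < t, t < 1 &
     w = ((1 - t) * u.1 + t * v.1, (1 - t) * u.2 + t * v.2)]].

Definition segment (u v : plane) : set plane :=
  [set w | exists t : R, [/\ 0 <= t, t <= 1 &
     w = ((1 - t) * u.1 + t * v.1, (1 - t) * u.2 + t * v.2)]].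

Definition joint (adj : plane -> plane -> Prop) (u : plane) : Prop :=
  exists a b, a <> b /\ forall w, adj u w <-> (w = a \/ w = b).

(** Two straight strands meet at a crossing; they are automatically transverse
    in a diagram, because edges do not overlap. *)
Definition crossing (adj : plane -> plane -> Prop) (u : plane) : Prop :=
  exists a a' b b', [/\ uniq [:: a; a'; b; b'],
    open_segment a a' u, open_segment b b' u &
    forall w, adj u w <-> w \in [:: a; a'; b; b']].

(** [over u v] says that [u] is a crossing and that the edge [uv] belongs, at
    its end [u], to the upper strand of this crossing. *)
Record diagram := Diagram {
  adj : plane -> plane -> Prop;
  over : plane -> plane -> Prop;
  adj_finite : finite_set [set e : plane * plane | adj e.1 e.2];
  adj_sym : forall u v, adj u v -> adj v u;
  adj_irrefl : forall u, ~ adj u u;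
  adj_embedded : forall u v u' v' w, adj u v -> adj u' v' ->
    open_segment u v w -> segment u' v' w ->
    (u' = u /\ v' = v) \/ (u' = v /\ v' = u);
  adj_valency : forall u v, adj u v -> joint adj u \/ crossing adj u;
  over_crossing : forall u v, over u v -> crossing adj u /\ adj u v;
  over_strand : forall u a b, crossing adj u -> adj u a -> adj u b ->
    (over u a <-> over u b) <-> (a = b \/ open_segment a b u)
}.

(** * Arcs and colorings

    A pair [(u, v)] of adjacent vertices stands for the half of the edge [uv]
    at [u].  An arc is encoded as the set of its half-edges. *)

Inductive joined (D : diagram) : plane * plane -> plane * plane -> Prop :=
| joined_edge u v : adj D u v -> joined D (u, v) (v, u)
| joined_joint u v w : joint (adj D) u -> adj D u v -> adj D u w ->
    joined D (u, v) (u, w)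
| joined_over u v w : over D u v -> over D u w -> joined D (u, v) (u, w).

Definition arc (D : diagram) : Type :=
  {A : set (plane * plane) | exists2 e, adj D e.1 e.2 &
     A = [set f | clos_refl_sym_trans _ (joined D) e f]}.

(** At the crossing [x], [(x, b)] is on the over-arc and [(x, a)], [(x, a')]
    are the two opposite ends of the under-strand. *)
Definition is_coloring (X : quandle) (D : diagram) (c : arc D -> X) : Prop :=
  forall (x b a a' : plane) (B A A' : arc D),
    over D x b -> adj D x a -> adj D x a' -> ~ over D x a ->
    open_segment a a' x ->
    sval B (x, b) -> sval A (x, a) -> sval A' (x, a') ->
    c A' = (c B ▷ c A)%quandle.

Definition coloring (X : quandle) (D : diagram) : Type :=
  {c : arc D -> X | is_coloring c}.

(** * Reidemeister moves *)

Definition unit_disc : set plane := [set p | p.1 ^+ 2 + p.2 ^+ 2 <= 1].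

Definition is_disc (B : set plane) : Prop :=
  exists g : plane -> plane,
    [/\ {within unit_disc, continuous g}, set_inj unit_disc g &
        B = g @` unit_disc].

(** The edges of a path [s] of vertices, each listed in both directions. *)
Definition path_edges (s : seq plane) : seq (plane * plane) :=
  zip s (behead s) ++ zip (behead s) s.

Definition path_ends (s : seq plane) : seq plane :=
  [:: head 0 s; last 0 s].

(** A path in the diagram that goes straight ahead at crossings. *)
Definition strand (D : diagram) (s : seq plane) : Prop :=
  [/\ (1 < size s)%N,
      forall i, (i.+1 < size s)%N -> adj D s`_i s`_i.+1 &
      forall i, (i.+2 < size s)%N -> crossing (adj D) s`_i.+1 ->
        open_segment s`_i s`_i.+2 s`_i.+1].

(** [tangle D B ss]: the part of [D] in the disc [B] consists of the strands
    [ss], which run in the interior of [B] except for their pairwise distinct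
    ends; the latter are 2-valent vertices on the boundary of [B]. *)
Record tangle (D : diagram) (B : set plane) (ss : seq (seq plane)) : Prop :=
  Tangle {
  tangle_disc : is_disc B;
  tangle_strand : forall s, s \in ss -> strand D s;
  tangle_uniq_edges : uniq (flatten [seq path_edges s | s <- ss]);
  tangle_uniq_ends : uniq (flatten [seq path_ends s | s <- ss]);
  tangle_ends : forall s u, s \in ss -> u \in path_ends s ->
    [/\ joint (adj D) u, B u & ~ interior B u];
  tangle_interior : forall s i, s \in ss -> (0 < i)%N -> (i.+1 < size s)%N ->
    interior B s`_i;
  tangle_edges_in : forall s u v, s \in ss -> (u, v) \in path_edges s ->
    open_segment u v `<=` interior B;
  tangle_edges_out : forall u v, adj D u v ->
    (forall s, s \in ss -> (u, v) \notin path_edges s) ->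
    open_segment u v `&` B = set0;
  tangle_vertices : forall u v, adj D u v -> B u ->
    exists2 s, s \in ss & u \in s
}.

(** The crossings met along a path, with [true] for overpasses. *)
Fixpoint gauss_code (D : diagram) (s : seq plane) : seq (plane * bool) :=
  match s with
  | x :: ((y :: _) as s') =>
      if `[< crossing (adj D) x >] then (x, `[< over D x y >]) :: gauss_code D s'
      else gauss_code D s'
  | _ => [::]
  end.

(** Before and after each move, in terms of the Gauss codes of the strands in
    a disc.  In a disc these codes determine the usual pictures.  Strands carry
    no orientation, so the direction in which each one is read is chosen so as
    to leave a single case for each move.  [R0_arc] and [R0_crossing] (with the
    insertion of flat vertices below) generate planar isotopy. *)
Inductive move_pattern :
    seq (seq (plane * bool)) -> seq (seq (plane * bool)) -> Prop :=
| R0_arc :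
    move_pattern [:: [::]] [:: [::]]
| R0_crossing x x' :
    move_pattern [:: [:: (x, true)]; [:: (x, false)]]
                 [:: [:: (x', true)]; [:: (x', false)]]
| R1_kink x o :
    move_pattern [:: [::]] [:: [:: (x, o); (x, ~~ o)]]
| R2_bigon x y :
    move_pattern [:: [::]; [::]]
                 [:: [:: (x, true); (y, true)]; [:: (x, false); (y, false)]]
| R3_triangle x y z x' y' z' :
    move_pattern
      [:: [:: (x, true); (y, true)];
          [:: (x, false); (z, true)];
          [:: (y, false); (z, false)]]
      [:: [:: (y', true); (x', true)];
          [:: (z', true); (x', false)];
          [:: (z', false); (y', false)]].

Definition local_move (B : set plane) (D D' : diagram) : Prop :=
  (forall u v, ~ (open_segment u v `<=` interior B) ->
     (adj D u v <-> adj D' u v)) /\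
  (forall u v, ~ B u -> (over D u v <-> over D' u v)) /\
  exists ss ss',
    [/\ tangle D B ss, tangle D' B ss',
        [seq path_ends s | s <- ss] = [seq path_ends s | s <- ss'] &
        move_pattern [seq gauss_code D s | s <- ss]
                     [seq gauss_code D' s | s <- ss']].

Definition same_edge (a b u v : plane) : Prop :=
  (a = u /\ b = v) \/ (a = v /\ b = u).

(** Insertion of a flat vertex [m] in the interior of the edge [uv]. *)
Definition subdivision (D D' : diagram) : Prop :=
  exists u v m, [/\ adj D u v, open_segment u v m,
    forall a b, adj D' a b <->
      [\/ adj D a b /\ ~ same_edge a b u v,
          same_edge a b u m | same_edge a b m v],
    forall a b, ~ same_edge a b u v -> ~ same_edge a b u m ->
      ~ same_edge a b m v -> (over D a b <-> over D' a b) &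
    (over D u v <-> over D' u m) /\ (over D v u <-> over D' v m)].

Inductive move_site := Subdivide | InDisc of set plane.

Definition move_at (S : move_site) (D D' : diagram) : Prop :=
  match S with
  | Subdivide => subdivision D D'
  | InDisc B => local_move B D D'
  end.

Record move (D D' : diagram) := Move {
  site : move_site;
  move_valid : move_at site D D' \/ move_at site D' D
}.

Definition rev_move D D' (m : move D D') : move D' D :=
  Move (proj1 (or_comm _ _) (move_valid m)).

Lemma rev_moveK D D' (m : move D D') : rev_move (rev_move m) = m.
Proof. by case: m => S v; congr Move; exact: Prop_irrelevance. Qed.

(** * The groupoid of link diagrams *)

Inductive moves : diagram -> diagram -> Type :=
| mnil D : moves D D
| mcons D E F : move D E -> moves E F -> moves D F.

Fixpoint mcat D E F (w : moves D E) : moves E F -> moves D F :=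
  match w in moves D E return moves E F -> moves D F with
  | mnil _ => fun w' => w'
  | mcons _ _ _ m w => fun w' => mcons m (mcat w w')
  end.

Inductive moves_eq : forall D E, moves D E -> moves D E -> Prop :=
| meq_refl D E (w : moves D E) : moves_eq w w
| meq_sym D E (w w' : moves D E) : moves_eq w w' -> moves_eq w' w
| meq_trans D E (w w' w'' : moves D E) :
    moves_eq w w' -> moves_eq w' w'' -> moves_eq w w''
| meq_cons D E F (m : move D E) (w w' : moves E F) :
    moves_eq w w' -> moves_eq (mcons m w) (mcons m w')
| meq_cancel D E F (m : move D E) (w : moves D F) :
    moves_eq (mcons m (mcons (rev_move m) w)) w.

Lemma moves_eq_equiv D E : Equivalence (@moves_eq D E).
Proof.
split=> [w|w w'|w w' w'']; [exact: meq_refl|exact: meq_sym|exact: meq_trans].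
Qed.

Lemma mcat_nil D E (w : moves D E) : mcat w (mnil E) = w.
Proof. by elim: w => //= D1 E1 F1 m w ->. Qed.

Lemma mcatA D E F G (u : moves D E) (v : moves E F) (w : moves F G) :
  mcat u (mcat v w) = mcat (mcat u v) w.
Proof. by elim: u v => //= D1 E1 F1 m u IH v; rewrite IH. Qed.

Lemma mcat_eq D E F (u u' : moves D E) (v v' : moves E F) :
  moves_eq u u' -> moves_eq v v' -> moves_eq (mcat u v) (mcat u' v').
Proof.
move=> uu' vv'; apply: (@meq_trans _ _ _ (mcat u v')).
  by elim: u v v' vv' {uu'} => //= *; apply: meq_cons; auto.
move: v' {v vv'}.
elim: uu' => {D E u u'} [D E w|D E w w' _ IH|D E w w' w'' _ IH _ IH'
  |D E G m w w' _ IH|D E G m w] v /=.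
- exact: meq_refl.
- exact: meq_sym.
- exact: meq_trans (IH' v).
- exact: meq_cons.
- exact: meq_cancel.
Qed.

Definition KDiag : category :=
  @Category diagram moves moves_eq mnil mcat moves_eq_equiv mcat_eq
    (fun _ _ w => meq_refl w)
    (fun _ _ w => eq_ind_r (fun w' => moves_eq w' w) (meq_refl w) (mcat_nil w))
    (fun _ _ _ _ u v w =>
       eq_ind_r (fun w' => moves_eq w' (mcat (mcat u v) w)) (meq_refl _)
         (mcatA u v w)).

Lemma KDiag_groupoid : is_groupoid KDiag.
Proof.
move=> A B; elim=> {A B} [D|D E F m w [w' [h1 h2]]] /=.
  by exists (mnil D); split; exact: meq_refl.
exists (mcat w' (mcons (rev_move m) (mnil D))); split.
  rewrite mcatA; apply: meq_trans (meq_cancel m (mnil D)); apply: meq_cons.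
  exact: (mcat_eq h1 (meq_refl (mcons (rev_move m) (mnil D)))).
rewrite -mcatA /=; apply: meq_trans h2; apply: mcat_eq (meq_refl _) _.
by have := meq_cancel (rev_move m) w; rewrite rev_moveK.
Qed.

End Diagrams.

(* Main.v *)
From mathcomp Require Import all_boot all_order all_algebra.
From mathcomp Require Import all_classical all_reals all_analysis.
From mathcomp Require Import ring lra.
From Stdlib Require Import Relation_Operators.
Require Import Defs.

(** A move changes a diagram only inside a disc, or by a flat vertex on an edge,
    and a coloring of one side extends from the unchanged part to exactly one
    coloring of the other side.  So each move [m] gives a function [recolor m]
    between sets of colorings, characterized by [agree_off]: at points off the
    disc the colors are the same.  This relation is symmetric in the two
    diagrams, whence reversed moves give inverse functions ([recolorK]) and the
    functions are compatible with the relations of the groupoid.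

    Existence and uniqueness of the new coloring are proved for functions on
    half-edges, which amount to colorings ([half_edges_of_coloring],
    [coloring_of_half_edges]) but can be defined edge by edge.  For a
    subdivision, half-edges of the two diagrams with the same germ at a vertex
    correspond to each other ([color_subdivision], [color_merge]).

    For a disc, a coloring is read along the strands.  Its color changes only at
    underpasses, by the color of the upper strand, so all that matters is the
    Gauss codes, the colors at the ends of the strands, and the colors of the
    upper strands at the crossings ([gauss_code_coloringP]).  On codes, the
    moves are the computations with the quandle axioms in
    [codes_coloring_move], and a coloring of codes is determined by the colors
    at the ends ([codes_coloring_determined]).  Going back from codes to
    half-edges gives existence ([tangle_extend]) and uniqueness
    ([tangle_rigid]).  The geometry enters in three facts: edges do not overlap,
    so a strand has only one continuation at a crossing ([opposite_unique]); all
    edges at an interior vertex of the disc belong to strands through it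
    ([interior_visit]); and an end of a strand has a further edge outside the
    disc, which fixes its color ([end_outside]). *)

Set Implicit Arguments.
Unset Strict Implicit.
Unset Printing Implicit Defensive.

Import Order.TTheory GRing.Theory Num.Theory.
Import numFieldNormedType.Exports.

Local Open Scope classical_set_scope.
Local Open Scope ring_scope.
Local Open Scope quandle_scope.

(** * Segments *)

Section Segments.
Variable R : realType.
Implicit Types u v w x a b : (R * R)%type.

Lemma open_segmentC u v w : open_segment u v w -> open_segment v u w.
Proof.
by move=> [t [t0 t1 ->]]; exists (1 - t); split; [lra|lra|congr pair; ring].
Qed.

Lemma open_segment_segment u v w : open_segment u v w -> segment u v w.
Proof. by move=> [t [t0 t1 ->]]; exists t; split => //; exact: ltW. Qed.

Lemma segment_endl u v : segment u v u.
Proof. by exists 0; split => //; case: u => u1 u2 /=; congr pair; ring. Qed.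

Lemma open_segment_nonempty u v : exists w, open_segment u v w.
Proof. by eexists; exists (1 / 2); split; [lra|lra|reflexivity]. Qed.

Lemma open_segment_endl u v : open_segment u v u -> u = v.
Proof.
case: u v => u1 u2 [v1 v2] [t [t0 t1 /= [e1 e2]]].
have cancel (p q : R) : p = (1 - t) * p + t * q -> p = q.
  move=> e; have /eqP : t * (p - q) = 0.
    have -> : t * (p - q) = p - ((1 - t) * p + t * q) by ring.
    by rewrite -e subrr.
  by rewrite mulf_eq0 subr_eq0 gt_eqF //= => /eqP.
by rewrite (cancel _ _ e1) (cancel _ _ e2).
Qed.

(** Seen from the middle point only the rays matter; opposite ends of a strand
    at a vertex are compared in this form. *)
Lemma open_segmentP a b x : open_segment a b x <->
  exists k : R, [/\ 0 < k, b.1 = x.1 + k * (x.1 - a.1) &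
                    b.2 = x.2 + k * (x.2 - a.2)].
Proof.
split=> [[t [t0 t1 ->]]|[k [k0 e1 e2]]] /=.
  exists ((1 - t) / t); split; first by apply: divr_gt0; lra.
    by field; rewrite gt_eqF.
  by field; rewrite gt_eqF.
have k1 : 1 + k != 0 by rewrite gt_eqF //; lra.
exists (1 + k)^-1; split.
- by rewrite invr_gt0; lra.
- by rewrite invf_lt1; lra.
- by rewrite e1 e2; case: x {e1 e2} => x1 x2 /=; congr pair; field.
Qed.

Lemma open_segment_subl u v m w :
  open_segment u v m -> open_segment u m w -> open_segment u v w.
Proof.
move=> [s [s0 s1 ->]] [t [t0 t1 ->]] /=; exists (t * s); split.
- exact: mulr_gt0.
- by rewrite mulr_ilt1 // ltW.
- by congr pair; ring.
Qed.

(** Only the ray from [u] matters, so a new vertex on an edge does not change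
    which half-edges go straight ahead into each other at its ends. *)
Lemma open_segment_shorten u v m b :
  open_segment u v m -> open_segment b v u <-> open_segment b m u.
Proof.
case: u v m b => u1 u2 [v1 v2] [m1 m2] [b1 b2].
move=> [t [t0 t1 /= [-> ->]]]; rewrite !open_segmentP /=.
split=> [[k [k0 -> ->]]|[k [k0 e1 e2]]].
  by exists (t * k); split; [exact: mulr_gt0|ring|ring].
exists (k / t); split; first exact: divr_gt0.
- by apply: (mulfI (lt0r_neq0 t0)); rewrite -(addrK ((1 - t) * u1) (t * v1))
    (addrC (t * v1)) e1; field; rewrite gt_eqF.
- by apply: (mulfI (lt0r_neq0 t0)); rewrite -(addrK ((1 - t) * u2) (t * v2))
    (addrC (t * v2)) e2; field; rewrite gt_eqF.
Qed.

(** Both [b] and [c] lie on the ray from [x] opposite to [a].  As edges do not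
    overlap, this makes the continuation of a strand unique, see
    [opposite_unique]. *)
Lemma open_segments_overlap a b c x : open_segment a b x -> open_segment a c x ->
  exists w, open_segment x b w /\ open_segment x c w.
Proof.
move=> /open_segmentP[k [k0 b1 b2]] /open_segmentP[l [l0 c1 c2]].
(* The point at distance [t k l] from [x], in units of [x - a], with [t]
   small enough for it to come before both [b] and [c]. *)
pose t := (k + l + 1)^-1.
have kl : k + l + 1 != 0 by rewrite gt_eqF //; lra.
have t0 : 0 < t by rewrite invr_gt0; lra.
have tk : t * (k + l + 1) = 1 by rewrite mulVf.
exists (x.1 + t * k * l * (x.1 - a.1), x.2 + t * k * l * (x.2 - a.2)).
split.
  exists (t * l); split; [exact: mulr_gt0|nra|].
  by rewrite b1 b2; congr pair; ring.
exists (t * k); split; [exact: mulr_gt0|nra|].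
by rewrite c1 c2; congr pair; ring.
Qed.

(** By continuity: the points of the segment close to [u] are in [B]. *)
Lemma open_segment_meets_interior (B : set (R * R)) u v :
  interior B u -> open_segment u v `&` B !=set0.
Proof.
move=> Bu.
pose f (t : R) : R * R := ((1 - t) * u.1 + t * v.1, (1 - t) * u.2 + t * v.2).
have f0 : f 0 = u by rewrite /f; case: (u) => u1 u2 /=; congr pair; ring.
have cl (p q : R) : (1 - t) * p + t * q @[t --> (0 : R)] --> (1 - 0) * p + 0 * q.
  apply: cvgD; apply: cvgM; (try exact: cvg_cst); (try exact: cvg_id).
  by apply: cvgB; [exact: cvg_cst|exact: cvg_id].
have cf : f @ (0 : R) --> f 0.
  exact: (cvg_pair (cl u.1 v.1) (cl u.2 v.2)).
have /cf : nbhs (f 0) B by rewrite f0.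
move=> /nbhs_ballP[e /= e0 eB].
pose t := Num.min (e / 2) (1 / 2) : R.
have t0 : 0 < t by rewrite lt_min; apply/andP; split; lra.
have te : t < e by rewrite gt_min; apply/orP; left; lra.
have t1 : t < 1 by rewrite gt_min; apply/orP; right; lra.
exists (f t); split; first by exists t.
apply: eB; rewrite /= /ball /= sub0r normrN gtr0_norm //.
Qed.

End Segments.

(** * Diagrams near a vertex *)

Section Vertices.
Variables (R : realType) (D : diagram R).
Implicit Types u v w x a b : (R * R)%type.

Lemma embedded_edges u v u' v' w : adj D u v -> adj D u' v' ->
  open_segment u v w -> open_segment u' v' w -> same_edge u' v' u v.
Proof.
by move=> uv uv' w1 w2; exact: (adj_embedded uv uv' w1 (open_segment_segment w2)).
Qed.

Lemma opposite_unique x a b c : adj D x b -> adj D x c ->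
  open_segment a b x -> open_segment a c x -> b = c.
Proof.
move=> xb xc abx acx; have [w [wb wc]] := open_segments_overlap abx acx.
have [[_ //]|[xc' bx]] := embedded_edges xc xb wc wb.
by rewrite bx -xc'.
Qed.

Lemma joint_crossing x : joint (adj D) x -> ~ crossing (adj D) x.
Proof.
move=> [a [b [_ ab]]] [p [p' [q [q' [/= U _ _ pq]]]]].
have H w : w \in [:: p; p'; q; q'] -> w \in [:: a; b].
  by move=> /pq /ab; rewrite !inE => -[] ->; rewrite eqxx ?orbT.
by have := uniq_leq_size (s1 := [:: p; p'; q; q']) U H.
Qed.

Lemma over_opposite x a b : crossing (adj D) x -> adj D x a -> adj D x b ->
  open_segment a b x -> (over D x a <-> over D x b).
Proof. by move=> cx xa xb abx; apply/(over_strand cx xa xb); right. Qed.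

(** The two strands at a crossing differ with respect to [over], so one of them
    is the upper one. *)
Lemma crossing_over x : crossing (adj D) x -> exists b, over D x b.
Proof.
move=> cx; have [p [p' [q [q' [/= U pp qq pq]]]]] := cx.
have [xp xp' xq] : [/\ adj D x p, adj D x p' & adj D x q].
  by split; apply/pq; rewrite !inE eqxx ?orbT.
case: (pselect (over D x p)) => [|np]; first by exists p.
case: (pselect (over D x q)) => [|nq]; first by exists q.
have pxq : over D x p <-> over D x q by split.
have [pq'|ppx] := (over_strand cx xp xq).1 pxq.
  by move: U; rewrite pq' /= !inE eqxx orbT.
by move: U; rewrite (opposite_unique xp' xq pp ppx) /= !inE eqxx /= ?andbF.
Qed.

Lemma jointE x a : adj D x a ->
  joint (adj D) x <-> forall v, ~ over D x v.
Proof.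
move=> xa; split=> [jx v /over_crossing[cx _]|nx].
  exact: (joint_crossing jx).
have [//|/crossing_over[b /nx //]] := adj_valency xa.
Qed.

End Vertices.

(** * Colorings as functions on half-edges *)

(** The condition on the colors [k a] of the half-edges [(x, a)] at a vertex
    [x].  It mentions only [adj D], [over D] and betweenness; joints are
    recognized by the absence of an upper strand, see [jointE]. *)
Record vertex_coloring (R : realType) (X : quandle) (D : diagram R)
    (x : R * R) (k : R * R -> X) : Prop := VertexColoring {
  vertex_joint : forall a b, adj D x a -> adj D x b ->
    (forall v, ~ over D x v) -> k a = k b;
  vertex_over : forall a b, over D x a -> over D x b -> k a = k b;
  vertex_under : forall b a a', over D x b -> adj D x a -> adj D x a' ->
    ~ over D x a -> open_segment a a' x -> k a' = k b ▷ k a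
}.

Record half_edge_coloring (R : realType) (X : quandle) (D : diagram R)
    (h : R * R -> R * R -> X) : Prop := HalfEdgeColoring {
  half_edge_sym : forall u v, adj D u v -> h u v = h v u;
  half_edge_vertex : forall x, vertex_coloring D x (h x)
}.

Definition paints (R : realType) (X : quandle) (D : diagram R)
    (h : R * R -> R * R -> X) (c : arc D -> X) : Prop :=
  forall (A : arc D) u v, sval A (u, v) -> c A = h u v.

Section HalfEdges.
Variables (R : realType) (X : quandle) (D : diagram R).
Implicit Types (u v x a b : (R * R)%type) (A : arc D) (h : R * R -> R * R -> X).

Lemma arc_at u v : adj D u v -> exists A, sval A (u, v).
Proof.
move=> uv.
pose S := [set f | clos_refl_sym_trans _ (joined D) (u, v) f].
have HS : exists2 e, adj D e.1 e.2 &
    S = [set f | clos_refl_sym_trans _ (joined D) e f] by exists (u, v).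
by exists (exist _ S HS); exact: rst_refl.
Qed.

Lemma arc_joined A e f : sval A e -> joined D e f -> sval A f.
Proof.
case: A => S [e0 _ /= ->] /= e0e ef.
by apply: rst_trans e0e _; exact: rst_step.
Qed.

Lemma arc_unique A A' e : sval A e -> sval A' e -> A = A'.
Proof.
case: A A' => [S HS] [S' HS'] /= Se S'e; apply: eq_exist => /=.
case: HS HS' Se S'e => [e1 _ ->] [e2 _ ->] /= e1e e2e.
by apply/seteqP; split=> f /= H; [apply: rst_trans e2e _|apply: rst_trans e1e _];
  (apply: rst_trans _ H; exact: rst_sym).
Qed.

Lemma arc_adj A u v : sval A (u, v) -> adj D u v.
Proof.
case: A => S [e e12 /= ->] /= /=.
suff H f g : clos_refl_sym_trans _ (joined D) f g ->
    adj D f.1 f.2 <-> adj D g.1 g.2 by move/H => /= <-.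
elim=> {f g} [f g| |f g _ []|f g k _ [fg gf] _ [gk kg]] //; last first.
  by split=> [/fg/gk|/kg/gf].
case=> /= [a b ab|x a b _ xa xb|x a b /over_crossing[_ xa] /over_crossing[_ xb]] //.
by split=> [/adj_sym|_].
Qed.

(** [X] may be empty; a point [x0] of it gives the value of the function at the
    pairs that are not half-edges. *)
Lemma half_edges_of_coloring (x0 : X) (c : coloring X D) :
  exists2 h, half_edge_coloring D h & paints h (sval c).
Proof.
pose h u v : X :=
  if pselect (exists A, sval A (u, v)) is left H then sval c (sval (cid H))
  else x0.
have hE A u v : sval A (u, v) -> h u v = sval c A.
  move=> Auv; rewrite /h; case: pselect => [H|[]]; last by exists A.
  by case: cid => A' /= A'uv; congr (sval c _); exact: arc_unique A'uv Auv.
have h_joined u v u' v' : adj D u v -> joined D (u, v) (u', v') ->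
    h u v = h u' v'.
  move=> /arc_at[A Auv] J; rewrite (hE _ _ _ Auv).
  by rewrite (hE _ _ _ (arc_joined Auv J)).
exists h; last by move=> A u v /hE ->.
split=> [u v uv|x]; last split=> [a b xa xb nx|a b xa xb|b a a' xb xa xa' nxa aa'].
- by apply: h_joined => //; exact: joined_edge.
- by apply: h_joined => //; apply: joined_joint => //; apply/(jointE xa).
- apply: h_joined; last exact: joined_over.
  by have [] := over_crossing xa.
- have [_ ad] := over_crossing xb.
  have [[B Bb] [A Aa] [A' Aa']] := And3 (arc_at ad) (arc_at xa) (arc_at xa').
  rewrite (hE _ _ _ Bb) (hE _ _ _ Aa) (hE _ _ _ Aa').
  exact: (proj2_sig c x b a a' B A A').
Qed.

Lemma coloring_of_half_edges h : half_edge_coloring D h ->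
  exists c : coloring X D, paints h (sval c).
Proof.
move=> H.
have rep A : exists e, sval A e.
  by case: A => S [e ? /= Se]; exists e; rewrite Se; exact: rst_refl.
pose c A := let e := sval (cid (rep A)) in h e.1 e.2.
have cP : paints h c.
  have joinedE f g : clos_refl_sym_trans _ (joined D) f g -> h f.1 f.2 = h g.1 g.2.
    elim=> {f g} [f g|//|f g _ -> //|f g k _ -> _ -> //].
    case=> /= [u v /(half_edge_sym H) //|x a b jx xa xb|x a b xa xb].
      exact: (vertex_joint (half_edge_vertex H x) xa xb ((jointE xa).1 jx)).
    exact: (vertex_over (half_edge_vertex H x) xa xb).
  move=> A u v; rewrite /c; case: cid => [[u' v']] /=.
  case: A => S [e _ /= Se]; rewrite /= Se => e1 e2; apply: (joinedE (u', v') (u, v)).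
  by apply: rst_trans e2; exact: rst_sym.
suff cc : is_coloring c by exists (exist _ c cc).
move=> x b a a' B A A' xb xa xa' nxa aa' Bb Aa Aa'.
rewrite (cP _ _ _ Bb) (cP _ _ _ Aa) (cP _ _ _ Aa').
exact: (vertex_under (half_edge_vertex H x) xb xa xa' nxa aa').
Qed.

End HalfEdges.

(** * Colorings of two diagrams that agree off a set *)

Section Agreement.
Variables (R : realType) (X : quandle).
Implicit Types (D : diagram R) (h : R * R -> R * R -> X) (S : set (R * R)).

(** The colors are compared at points of the plane, so that no matching of the
    edges of [D] with those of [D'] is needed. *)
Definition agree_off D D' S (c : coloring X D) (c' : coloring X D') : Prop :=
  forall (A : arc D) (A' : arc D') u v u' v' w, sval A (u, v) ->
    sval A' (u', v') -> open_segment u v w -> open_segment u' v' w -> ~ S w ->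
    sval c A = sval c' A'.

Definition half_edges_agree_off D D' S h h' : Prop :=
  forall u v u' v' w, adj D u v -> adj D' u' v' ->
    open_segment u v w -> open_segment u' v' w -> ~ S w -> h u v = h' u' v'.

Lemma agree_off_sym D D' S (c : coloring X D) (c' : coloring X D') :
  agree_off S c c' -> agree_off S c' c.
Proof.
by move=> cc' A' A u' v' u v w A'u Au wu' wu Sw; rewrite (cc' A A' u v u' v' w).
Qed.

Lemma agree_offP D D' S (c : coloring X D) (c' : coloring X D') h h' :
  paints h (sval c) -> paints h' (sval c') ->
  agree_off S c c' <-> half_edges_agree_off D D' S h h'.
Proof.
move=> hc hc'; split=> [cc' u v u' v' w uv uv' wuv wuv' Sw|hh'].
  have [[A Auv] [A' Auv']] := (arc_at uv, arc_at uv').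
  by rewrite -(hc _ _ _ Auv) -(hc' _ _ _ Auv'); exact: cc' Auv Auv' wuv wuv' Sw.
move=> A A' u v u' v' w Auv Auv' wuv wuv' Sw.
rewrite (hc _ _ _ Auv) (hc' _ _ _ Auv').
exact: hh' (arc_adj Auv) (arc_adj Auv') wuv wuv' Sw.
Qed.

Lemma coloring_ext D (c c' : coloring X D) h h' :
  paints h (sval c) -> paints h' (sval c') ->
  (forall u v, adj D u v -> h u v = h' u v) -> c = c'.
Proof.
move=> hc hc' hh'.
case: c c' hc hc' => [c Hc] [c' Hc'] /= hc hc'; apply: eq_exist => /=.
apply/funext => A; have [[u v] Auv] : exists e, sval A e.
  by case: (A) => S [e ? /= Se]; exists e; rewrite Se; exact: rst_refl.
by rewrite (hc _ _ _ Auv) (hc' _ _ _ Auv); exact: hh' (arc_adj Auv).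
Qed.

Definition same_germ D D' x a a' : Prop :=
  [/\ adj D x a, adj D' x a', over D x a <-> over D' x a' &
      forall b, open_segment b a x <-> open_segment b a' x].

(** [vertex_coloring] sees only the germs of the half-edges at [x].  The second
    hypothesis makes [f] reach enough half-edges to tell joints from
    crossings. *)
Lemma vertex_coloring_transport D D' x (f : R * R -> R * R)
    (k k' : R * R -> X) :
  (forall a, adj D' x a -> same_germ D D' x (f a) a) ->
  (forall b, over D x b -> exists a, over D' x a) ->
  (forall a, adj D' x a -> k' a = k (f a)) ->
  vertex_coloring D x k -> vertex_coloring D' x k'.
Proof.
move=> germ ov k'E K.
split=> [a b xa xb nx|a b xa xb|b a a' xb xa xa' nxa aa'].
- have [[fa _ _ _] [fb _ _ _]] := (germ a xa, germ b xb).
  rewrite !k'E //; apply: (vertex_joint K) => // v /ov[w]; exact: nx.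
- have [[_ xa'] [_ xb']] := (over_crossing xa, over_crossing xb).
  have [[_ _ fa _] [_ _ fb _]] := (germ a xa', germ b xb').
  by rewrite !k'E //; apply: (vertex_over K); [apply/fa|apply/fb].
- have [_ xb'] := over_crossing xb.
  have [_ _ fb _] := germ b xb'.
  have [[fa _ oa sa] [fa' _ _ sa']] := (germ a xa, germ a' xa').
  rewrite !k'E //; apply: (vertex_under K) => //; first exact/fb.
    by move/oa.
  by apply/sa'/open_segmentC/sa/open_segmentC.
Qed.

End Agreement.

(** * Subdivisions *)

Section Subdivision.
Variables (R : realType) (X : quandle) (D D' : diagram R) (u v m : R * R).
Hypothesis uv : adj D u v.
Hypothesis uvm : open_segment u v m.
Hypothesis adjE : forall a b, adj D' a b <->
  [\/ adj D a b /\ ~ same_edge a b u v,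
      same_edge a b u m | same_edge a b m v].
Hypothesis overE : forall a b, ~ same_edge a b u v -> ~ same_edge a b u m ->
  ~ same_edge a b m v -> (over D a b <-> over D' a b).
Hypothesis over_u : over D u v <-> over D' u m.
Hypothesis over_v : over D v u <-> over D' v m.
Implicit Types (x a b w : (R * R)%type) (h : R * R -> R * R -> X).

Let uNv : u <> v.
Proof. by move=> e; apply: (@adj_irrefl _ D v); rewrite -{1}e. Qed.

Let mNu : m <> u.
Proof. by move=> e; apply: uNv; have := uvm; rewrite e => /open_segment_endl. Qed.

Let mNv : m <> v.
Proof.
move=> e; apply: uNv; have := uvm.
by rewrite e => /open_segmentC/open_segment_endl.
Qed.

Let not_adj_m b : ~ adj D m b.
Proof.
move=> mb; have [[] /mNu //|[] /mNv //] := adj_embedded uv mb uvm (segment_endl m b).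
Qed.

Let unsplit x a := if a == m then if x == u then v else u else a.
Let split_half x a := if `[< same_edge x a u v >] then m else a.

Let germ_u : same_germ D D' u v m.
Proof.
split=> //; first by apply/adjE/Or32; left.
by move=> b; exact: open_segment_shorten.
Qed.

Let germ_v : same_germ D D' v u m.
Proof.
split=> //; [exact: adj_sym|by apply/adjE/Or33; right|].
by move=> b; apply: open_segment_shorten; exact: open_segmentC.
Qed.

Let germ_same x a : adj D x a -> ~ same_edge x a u v -> same_germ D D' x a a.
Proof.
move=> xa nuv; have [xm am] : x <> m /\ a <> m.
  by split=> e; [move: xa|move: (adj_sym xa)]; rewrite e; exact: not_adj_m.
split=> //; first exact/adjE/Or31.
by apply: overE => // -[[]|[]].
Qed.

Let germ_split x a : adj D x a -> same_germ D D' x a (split_half x a).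
Proof.
move=> xa; rewrite /split_half; case: asboolP => [|nuv]; last exact: germ_same.
by case=> -[-> ->].
Qed.

Let germ_unsplit x a : x <> m -> adj D' x a ->
  same_germ D D' x (unsplit x a) a.
Proof.
move=> xm /adjE[[xa nuv]|[[-> ->]|[//]]|[[//]|[-> ->]]].
- rewrite /unsplit; case: eqP => [e|_]; last exact: germ_same.
  by case: (@not_adj_m x); rewrite -e; exact: adj_sym.
- by rewrite /unsplit !eqxx.
- by rewrite /unsplit eqxx; case: eqP => // /esym.
Qed.

Let joint_m : joint (adj D') m.
Proof.
exists u, v; split=> // w; split=> [/adjE[[/not_adj_m //]|[[]|[]]|[[]|[]]]|].
all: try by move=> *; by [left|right].
all: try by move=> /mNu.
all: try by move=> /mNv.
by case=> ->; apply/adjE; [apply/Or32; right|apply/Or33; left].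
Qed.

Let adj_um : adj D' u m. Proof. by apply/adjE/Or32; left. Qed.
Let adj_mv : adj D' m v. Proof. by apply/adjE/Or33; left. Qed.

Let not_over_m a : ~ over D' m a.
Proof. by move=> /over_crossing[cm _]; exact: (joint_crossing joint_m). Qed.

Let edges_meet a b a' b' w : adj D a b -> adj D' a' b' ->
    open_segment a b w -> open_segment a' b' w ->
  [/\ adj D a' b', ~ same_edge a' b' u v & same_edge a' b' a b] \/
  (same_edge a b u v /\ (same_edge a' b' u m \/ same_edge a' b' m v)).
Proof.
move=> ab a'b' wab wab'; case/adjE: (a'b') => [[ab' nuv]|um|mv].
- by left; split=> //; exact: (embedded_edges ab ab' wab wab').
- right; split; last by left.
  apply: (embedded_edges uv ab _ wab); apply: (open_segment_subl uvm).
  by case: um wab' => -[-> ->] // /open_segmentC.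
- right; split; last by right.
  apply: (embedded_edges uv ab _ wab); apply: open_segmentC.
  apply: (open_segment_subl (open_segmentC uvm)).
  by case: mv wab' => -[-> ->] // /open_segmentC.
Qed.

Let agreeI h h' : half_edge_coloring D h -> half_edge_coloring D' h' ->
  (forall a b, adj D a b -> ~ same_edge a b u v -> h a b = h' a b) ->
  h u v = h' u m -> h u v = h' m v -> half_edges_agree_off D D' set0 h h'.
Proof.
move=> H H' e1 e2 e3 a b a' b' w ab ab' wab wab' _.
have [[Dab' nuv]|] := edges_meet ab ab' wab wab'.
  by rewrite -e1 // => -[] [-> ->] //; exact: (half_edge_sym H).
have huv := half_edge_sym H uv.
have [hum hmv] := (half_edge_sym H' adj_um, half_edge_sym H' adj_mv).
by move=> [[[-> ->]|[-> ->]] [[[-> ->]|[-> ->]]|[[-> ->]|[-> ->]]]];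
  rewrite -?huv -?hum -?hmv.
Qed.

(** Both halves of [uv] take its color. *)
Lemma color_subdivision h : half_edge_coloring D h ->
  exists2 h', half_edge_coloring D' h' & half_edges_agree_off D D' set0 h h'.
Proof.
move=> H; pose h' x a := if x == m then h u v else h x (unsplit x a).
have huv := half_edge_sym H uv.
have h'D a b : adj D a b -> ~ same_edge a b u v -> h' a b = h a b.
  move=> ab nuv; rewrite /h' /unsplit.
  case: eqP => [e|_]; first by case: (@not_adj_m b); rewrite -e.
  by case: eqP => [e|//]; case: (@not_adj_m a); rewrite -e; exact: adj_sym.
have h'm a : h' m a = h u v by rewrite /h' eqxx.
have h'um : h' u m = h u v.
  by rewrite /h' /unsplit !eqxx; case: eqP.
have h'vm : h' v m = h u v.
  rewrite /h' /unsplit eqxx; case: eqP => // _.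
  by case: eqP => [/esym/uNv|_].
have H' : half_edge_coloring D' h'.
  split=> [a b /adjE[[ab nuv]|[[-> ->]|[-> ->]]|[[-> ->]|[-> ->]]]|x].
  - rewrite !h'D //; [exact: (half_edge_sym H)|exact: adj_sym|].
    by case=> -[e1 e2]; apply: nuv; [right|left].
  - by rewrite h'm.
  - by rewrite h'm.
  - by rewrite h'm.
  - by rewrite h'm.
  have [->|/eqP xm] := eqVneq x m.
    by split=> [a b _ _ _|a b /not_over_m //|b a a' /not_over_m //]; rewrite !h'm.
  apply: (@vertex_coloring_transport _ _ D D' x (unsplit x) (h x)).
  - by move=> a; exact: germ_unsplit.
  - move=> b xb; have [_ xb'] := over_crossing xb.
    by have [_ _ o _] := germ_split xb'; exists (split_half x b); apply/o.
  - by move=> a _; rewrite /h'; case: eqP.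
  - exact: (half_edge_vertex H).
by exists h' => //; apply: agreeI => // a b ab nuv; rewrite h'D.
Qed.

(** The halves of [uv] have the same color because [m] is a joint. *)
Lemma color_merge h' : half_edge_coloring D' h' ->
  exists2 h, half_edge_coloring D h & half_edges_agree_off D D' set0 h h'.
Proof.
move=> H'; pose h x a := h' x (split_half x a).
have hmm : h' m u = h' m v.
  by apply: (vertex_joint (half_edge_vertex H' m)) => //; exact: adj_sym.
have [hum hmv] := (half_edge_sym H' adj_um, half_edge_sym H' adj_mv).
have split_uv : split_half u v = m by rewrite /split_half asboolT //; left.
have split_vu : split_half v u = m by rewrite /split_half asboolT //; right.
have huv : h u v = h' u m by rewrite /h split_uv.
have hvu : h v u = h' v m by rewrite /h split_vu.
have hD a b : ~ same_edge a b u v -> h a b = h' a b.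
  by move=> nuv; rewrite /h /split_half asboolF.
have H : half_edge_coloring D h.
  split=> [a b ab|x].
    have [[[-> ->]|[-> ->]]|nuv] := pselect (same_edge a b u v).
    - by rewrite huv hvu hum hmm.
    - by rewrite huv hvu hum hmm.
    rewrite !hD //; last by case=> -[e1 e2]; apply: nuv; [right|left].
    by apply: (half_edge_sym H'); apply/adjE/Or31.
  have [->|/eqP xm] := eqVneq x m.
    by split=> [a b /not_adj_m //|a b /over_crossing[_ /not_adj_m //]
      |b a a' _ /not_adj_m //].
  apply: (@vertex_coloring_transport _ _ D' D x (split_half x) (h' x)) => //.
  - move=> a /germ_split[? ? o s]; split=> // [|b]; first by rewrite o.
    by rewrite s.
  - move=> b xb; have [_ xb'] := over_crossing xb.
    by have [_ _ o _] := germ_unsplit xm xb'; exists (unsplit x b); apply/o.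
  - exact: (half_edge_vertex H').
exists h => //; apply: agreeI => //; first by move=> a b _; exact: hD.
by rewrite huv hum hmm.
Qed.

(** Together with [subdivided_edge_covered]: a coloring on either side of a
    subdivision is determined by its agreement with one on the other side. *)
Lemma subdivision_edge_covered a b : adj D a b -> exists a' b' w,
  [/\ adj D' a' b', open_segment a b w & open_segment a' b' w].
Proof.
move=> ab; have [H|nuv] := pselect (same_edge a b u v); last first.
  have [w wab] := open_segment_nonempty a b.
  by exists a, b, w; split=> //; apply/adjE/Or31.
have [w wum] := open_segment_nonempty u m.
have wuv := open_segment_subl uvm wum.
exists u, m, w; split=> //.
by case: H => -[-> ->] //; exact: open_segmentC.
Qed.

Lemma subdivided_edge_covered a' b' : adj D' a' b' -> exists a b w,
  [/\ adj D a b, open_segment a b w & open_segment a' b' w].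
Proof.
move=> /adjE[[ab _]|H|H].
- have [w wab] := open_segment_nonempty a' b'.
  by exists a', b', w.
- have [w wum] := open_segment_nonempty u m.
  exists u, v, w; split=> //; first exact: (open_segment_subl uvm wum).
  by case: H => -[-> ->] //; exact: open_segmentC.
- have [w wvm] := open_segment_nonempty v m.
  exists u, v, w; split=> //.
    by apply/open_segmentC/(open_segment_subl (open_segmentC uvm)).
  by case: H => -[-> ->] //; exact: open_segmentC.
Qed.

End Subdivision.

(** * Colorings of Gauss codes *)

Section Codes.
Variables (R : realType) (X : quandle).
Implicit Types (omega : R * R -> X) (a b : X) (x : R * R)
  (cd : seq ((R * R) * bool)) (cds : seq (seq ((R * R) * bool))).

(** A strand enters with color [a], meets the crossings [cd], and leaves with
    color [b]; [omega x] is the color of the upper strand at the crossing [x]. *)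
Fixpoint code_coloring omega a cd b : Prop :=
  match cd with
  | [::] => a = b
  | (x, true) :: cd' => omega x = a /\ code_coloring omega a cd' b
  | (x, false) :: cd' => code_coloring omega (omega x ▷ a) cd' b
  end.

Fixpoint codes_coloring omega cds (ps : seq (X * X)) : Prop :=
  match cds, ps with
  | [::], [::] => True
  | cd :: cds', p :: ps' =>
      code_coloring omega p.1 cd p.2 /\ codes_coloring omega cds' ps'
  | _, _ => False
  end.

Lemma codes_coloring_map (I : eqType) (s : seq I) (f : I -> seq ((R * R) * bool))
    (p : I -> X * X) omega :
  codes_coloring omega [seq f i | i <- s] [seq p i | i <- s] <->
  forall i, i \in s -> code_coloring omega (p i).1 (f i) (p i).2.
Proof.
elim: s => [|i s IH] //=; rewrite IH; split=> [[Hi Hs] j|H].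
  by rewrite inE => /predU1P[->|/Hs].
by split=> [|j js]; apply: H; rewrite inE ?eqxx ?js ?orbT.
Qed.

(** Along the strands of a pattern, read in order, a crossing is met first as
    an overpass, except in a kink of the other kind; there, its upper strand is
    the outgoing one.  So the incoming and outgoing colors give all colors. *)
Lemma codes_coloring_determined cds cds' omega1 omega2 ps :
  move_pattern cds cds' \/ move_pattern cds' cds ->
  codes_coloring omega1 cds ps -> codes_coloring omega2 cds ps ->
  {in [seq p.1 | p <- flatten cds], omega1 =1 omega2}.
Proof.
case=> -[|y y'|y []|y z|y z t y' z' t'] /=;
  case: ps => [|[p1 p1'] [|[p2 p2'] [|[p3 p3'] [|p4 ps]]]] //= H1 H2 x;
  rewrite ?inE => xin; decompose [and] H1; decompose [and] H2; move: xin;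
  repeat (case/orP => [/eqP ->|]; first congruence);
    solve [done|move=> /eqP ->; congruence].
Qed.

(** The moves at the level of colors.  A kink uses that [▷] is idempotent, a
    bigon that it is involutory, a triangle that it is self-distributive.  The
    crossings need to have distinct names in order to be colored at will. *)
Lemma codes_coloring_move cds cds' omega ps : involutory X ->
  move_pattern cds cds' \/ move_pattern cds' cds -> uniq (flatten cds') ->
  codes_coloring omega cds ps -> exists omega', codes_coloring omega' cds' ps.
Proof.
move=> inv.
have invK (u v : X) : u ▷ (u ▷ v) = v by rewrite inv rtriK.
have rinj (u v w : X) : u ▷ v = u ▷ w -> v = w.
  by move=> /(congr1 (rtri u)); rewrite !invK.
case=> -[|y y'|y []|y z|y z t y' z' t'] /=;
  case: ps => [|[p1 p1'] [|[p2 p2'] [|[p3 p3'] [|p4 ps]]]] //= U H;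
  decompose [and] H.
all: try by exists (fun=> p1); intuition congruence.
- by exists (fun=> p1); rewrite rtri_idem.
- by exists (fun=> p1); rewrite rtri_idem.
- exists (fun q => if q == t' then p2 else p1).
  move: U; rewrite /= !inE !xpair_eqE !andbT !negb_or !eqxx => U.
  have [/negPf zt /negPf yt] : z' != t' /\ y' != t'.
    by split; apply: contraTT U => /negPn/eqP ->; rewrite eqxx /= ?andbF.
  rewrite zt yt; intuition; try congruence.
  have -> : p3' = p1 ▷ p2 ▷ (p1 ▷ p3) by congruence.
  exact: rtri_distr.
- by exists omega; intuition; rewrite -[p1]rtri_idem; congruence.
- have p1y : p1 = omega y by apply: (rinj (omega y)); rewrite rtri_idem; congruence.
  by exists omega; split=> //; congruence.
- exists (fun q => if q == t then p1 ▷ p2 else p1).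
  move: U; rewrite /= !inE !xpair_eqE !andbT !negb_or !eqxx => U.
  have [/negPf yt /negPf zt] : y != t /\ z != t.
    by split; apply: contraTT U => /negPn/eqP ->; rewrite eqxx /= ?andbF.
  rewrite zt yt; intuition; try congruence.
  by rewrite -rtri_distr; congruence.
Qed.
End Codes.

(** * Strands and their edges *)

Section Strands.
Variables (R : realType) (D : diagram R).
Implicit Types (s : seq (R * R)) (ss : seq (seq (R * R))) (u v x y : (R * R)%type).

Lemma size_edges s : size (zip s (behead s)) = (size s).-1 /\
  size (zip (behead s) s) = (size s).-1.
Proof.
rewrite !size_zip size_behead.
by split; [apply/minn_idPr|apply/minn_idPl]; exact: leq_pred.
Qed.

Lemma nth_edges s i : (i.+1 < size s)%N ->
  nth (0, 0) (zip s (behead s)) i = (s`_i, s`_i.+1) /\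
  nth (0, 0) (zip (behead s) s) i = (s`_i.+1, s`_i).
Proof.
have [sz sz'] := size_edges s; have -> : (i.+1 < size s)%N = (i < (size s).-1)%N.
  by case: (size s).
by move=> si; rewrite !nth_zip_cond sz sz' si !nth_behead.
Qed.

Lemma path_edgesP s u v : reflect
  (exists2 i, (i.+1 < size s)%N & same_edge u v s`_i s`_i.+1)
  ((u, v) \in path_edges s).
Proof.
have [sz sz'] := size_edges s.
have lt i : (i < (size s).-1)%N = (i.+1 < size s)%N by case: (size s).
rewrite mem_cat; apply: (iffP orP) => [[]|[i si uvE]].
- move=> /(nthP (0, 0))[i]; rewrite sz lt => si.
  by have [-> _] := nth_edges si => -[<- <-]; exists i => //; left.
- move=> /(nthP (0, 0))[i]; rewrite sz' lt => si.
  by have [_ ->] := nth_edges si => -[<- <-]; exists i => //; right.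
have [e e'] := nth_edges si.
by case: uvE => -[-> ->]; [left; rewrite -e|right; rewrite -e'];
  apply: mem_nth; rewrite ?sz ?sz' lt.
Qed.

Lemma path_edge_index s i j : uniq (path_edges s) ->
  (i.+1 < size s)%N -> (j.+1 < size s)%N ->
  same_edge s`_i s`_i.+1 s`_j s`_j.+1 -> i = j.
Proof.
have [sz sz'] := size_edges s.
have lt k : (k < (size s).-1)%N = (k.+1 < size s)%N by case: (size s).
rewrite cat_uniq => /and3P[U /hasPn U' _] si sj.
have [[ei _] [ej ej']] := (nth_edges si, nth_edges sj).
case=> -[e1 e2].
  apply/eqP; rewrite -(nth_uniq (0, 0) (s := zip s (behead s))) ?sz ?lt //.
  by rewrite ei ej e1 e2.
have /U'/= : nth (0, 0) (zip (behead s) s) j \in zip (behead s) s.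
  by apply: mem_nth; rewrite sz' lt.
rewrite ej' -e1 -e2 -ei => /negP[].
by apply: mem_nth; rewrite sz lt.
Qed.

Lemma uniq_flatten_map (I J : eqType) (f : I -> seq J) (r : seq I) :
  uniq (flatten [seq f i | i <- r]) ->
  {in r, forall i, uniq (f i)} /\
  {in r &, forall i j e, e \in f i -> e \in f j -> i = j}.
Proof.
elim: r => [|k r IH] //=.
rewrite cat_uniq => /and3P[Uk /hasPn disj /IH[U disj']].
have dk j e : j \in r -> e \in f j -> e \in f k -> False.
  move=> jr ej ek; have /disj/negP[] // : e \in flatten [seq f i | i <- r].
  by apply/flatten_mapP; exists j.
split=> [i|i j]; first by rewrite inE => /predU1P[->|/U].
rewrite !inE => /predU1P[->|ir] /predU1P[->|jr] e ei ej //.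
- by case: (dk j e).
- by case: (dk i e).
- exact: disj' ei ej.
Qed.

(** As in [code_coloring], [omega x] is the color of the upper strand at [x]; a
    strand comes to [x] with color [a] and goes on to [y] with color [b]. *)
Definition passes (X : quandle) (omega : R * R -> X) x y (a b : X) : Prop :=
  if `[< crossing (adj D) x >] then
    if `[< over D x y >] then omega x = a /\ b = a else b = omega x ▷ a
  else b = a.

Lemma passes_inj (X : quandle) (omega omega' : R * R -> X) x y a b b' :
  (crossing (adj D) x -> omega x = omega' x) ->
  passes omega x y a b -> passes omega' x y a b' -> b = b'.
Proof.
rewrite /passes; case: asboolP => [cx /(_ cx) ->|_ _ -> -> //].
by case: asboolP => _ => [[_ ->] [_ ->]|-> ->].
Qed.

(** No color changes at the joints, which a code leaves out.  Here [g i.+1] is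
    the color of the edge number [i], counted from [0], and [g 0] is the color
    before the first vertex. *)
Lemma gauss_code_coloringP (X : quandle) (omega : R * R -> X) s a b :
  code_coloring omega a (gauss_code D s) b <->
  exists g : nat -> X, [/\ g 0%N = a,
    forall i, (i.+1 < size s)%N -> passes omega s`_i s`_i.+1 (g i) (g i.+1) &
    g (size s).-1 = b].
Proof.
elim: s a => [|x s IH] a.
  by split=> [/= <-|[g [<- _ <-]]] //; exists (fun=> a).
case: s IH => [|y s] IH.
  by split=> [/= <-|[g [<- _ <-]]] //; exists (fun=> a).
have step : code_coloring omega a (gauss_code D [:: x, y & s]) b <->
    exists2 a', passes omega x y a a' &
      code_coloring omega a' (gauss_code D (y :: s)) b.
  rewrite /passes [gauss_code D (x :: _)]/=; case: asboolP => _ /=; last first.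
    by split=> [|[_ ->]] //; exists a.
  case: asboolP => _ /=; last by split=> [|[_ ->]] //; eexists; first reflexivity.
  by split=> [[ox H]|[_ [ox ->]]] //; exists a.
rewrite {}step; split=> [[a' xa' /IH[g [g0 gS gb]]]|[g [g0 gS gb]]].
  exists (fun i => if i is j.+1 then g j else a); split=> //.
  by case=> [_|i /gS //]; rewrite /= g0.
exists (g 1%N); first by rewrite -g0; exact: (gS 0%N isT).
by apply/IH; exists (fun i => g i.+1); split=> // i si; exact: (gS i.+1).
Qed.

Lemma mem_gauss_code s i : (i.+1 < size s)%N -> crossing (adj D) s`_i ->
  s`_i \in [seq p.1 | p <- gauss_code D s].
Proof.
elim: s i => [|x [|y s] IH] [|i] //= si ci; first by rewrite asboolT //= inE eqxx.
have H := IH i si ci.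
by case: ifP => // _; rewrite map_cons inE H orbT.
Qed.

Lemma gauss_codeE s : gauss_code D s = [seq (p.1, `[< over D p.1 p.2 >]) |
  p <- zip s (behead s) & `[< crossing (adj D) p.1 >]].
Proof.
elim: s => [|x [|y s] /= IH] //; rewrite IH /=.
by case: `[< crossing (adj D) x >].
Qed.

End Strands.

(** * Tangles *)

Definition inside (R : realType) (ss : seq (seq (R * R))) (u v : R * R) : Prop :=
  exists2 s, s \in ss & (u, v) \in path_edges s.

Section Tangles.
Variables (R : realType) (D : diagram R) (B : set (R * R)).
Variable ss : seq (seq (R * R)).
Hypothesis T : tangle D B ss.
Implicit Types (s t : seq (R * R)) (u v x a b : (R * R)%type).

Lemma inside_nth s i : s \in ss -> (i.+1 < size s)%N ->
  inside ss s`_i s`_i.+1 /\ inside ss s`_i.+1 s`_i.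
Proof.
by move=> sss si; split; exists s => //; apply/path_edgesP; exists i => //;
  [left|right].
Qed.

Lemma inside_sym u v : inside ss u v -> inside ss v u.
Proof.
move=> [s sss /path_edgesP[i si uvE]]; have [H H'] := inside_nth sss si.
by case: uvE => -[-> ->].
Qed.

Lemma inside_interior u v : inside ss u v -> open_segment u v `<=` interior B.
Proof. by move=> [s sss uvs]; exact: tangle_edges_in T _ _ _ sss uvs. Qed.

Lemma outside_off u v w : adj D u v -> ~ inside ss u v -> open_segment u v w -> ~ B w.
Proof.
move=> uv nuv wuv Bw; have e : open_segment u v `&` B = set0.
  apply: (tangle_edges_out T uv) => s sss; apply/negP => uvs.
  by apply: nuv; exists s.
by suff : (open_segment u v `&` B) w by rewrite e.
Qed.

Lemma strand_size s : s \in ss -> (1 < size s)%N.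
Proof. by case/(tangle_strand T). Qed.

Lemma strand_adj s i : s \in ss -> (i.+1 < size s)%N -> adj D s`_i s`_i.+1.
Proof. by move=> /(tangle_strand T)[_ H _]; exact: H. Qed.

Lemma strand_straight s i : s \in ss -> (i.+2 < size s)%N ->
  crossing (adj D) s`_i.+1 -> open_segment s`_i s`_i.+2 s`_i.+1.
Proof. by move=> /(tangle_strand T)[_ _ H]; exact: H. Qed.

Lemma strand_edge_unique s t i j : s \in ss -> t \in ss ->
  (i.+1 < size s)%N -> (j.+1 < size t)%N ->
  same_edge s`_i s`_i.+1 t`_j t`_j.+1 -> s = t /\ i = j.
Proof.
have [U U'] := uniq_flatten_map (tangle_uniq_edges T).
move=> sss tss si tj ij; suff st : s = t.
  by split=> //; subst t; exact: path_edge_index (U s sss) si tj ij.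
apply: (U' s t sss tss (s`_i, s`_i.+1)); apply/path_edgesP.
  by exists i => //; left.
by exists j.
Qed.

Lemma head_end s : s \in ss -> s`_0 \in path_ends s.
Proof. by rewrite nth0 inE eqxx. Qed.

Lemma last_end s : s \in ss -> s`_(size s).-1 \in path_ends s.
Proof. by rewrite nth_last !inE eqxx orbT. Qed.

Lemma end_not_interior s u : s \in ss -> u \in path_ends s -> ~ interior B u.
Proof. by move=> sss /(tangle_ends T sss)[]. Qed.

Lemma strand_vertex_in s i : s \in ss -> (i < size s)%N -> B s`_i.
Proof.
move=> sss si; case: i => [|i] in si *.
  by have [] := tangle_ends T sss (head_end sss).
have [si'|] := ltnP i.+2 (size s).
  by apply: interior_subset; apply: (tangle_interior T).
move=> si'; have -> : i.+1 = (size s).-1 by rewrite (@anti_leq (size s) i.+2) ?si'.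
by have [] := tangle_ends T sss (last_end sss).
Qed.

Lemma inside_in u v : inside ss u v -> B u.
Proof.
move=> [s sss /path_edgesP[i si [[-> _]|[-> _]]]]; apply: strand_vertex_in => //.
exact: ltnW.
Qed.

(** No edge leaves the interior of the disc at once, so all edges at an interior
    vertex belong to strands that pass through it. *)
Lemma interior_visit x a : interior B x -> adj D x a -> exists s i,
  [/\ s \in ss, (i.+2 < size s)%N, x = s`_i.+1 & a = s`_i \/ a = s`_i.+2].
Proof.
move=> Bx xa; have [s sss /path_edgesP[j sj xaE]] : inside ss x a.
  apply: contrapT => nxa; have [w [wxa]] := open_segment_meets_interior a Bx.
  exact: outside_off xa nxa wxa.
case: xaE => -[xE aE].
  case: j => [|j] in sj xE aE *; last by exists s, j; split=> //; right.
  by case: (end_not_interior sss (head_end sss)); rewrite -xE.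
have [sj'|sj'] := ltnP j.+2 (size s); first by exists s, j; split=> //; left.
case: (end_not_interior sss (last_end sss)).
by rewrite (@anti_leq (size s) j.+2) ?sj' //= -xE.
Qed.

Lemma visit_neighbors s i : s \in ss -> (i.+2 < size s)%N ->
  [/\ adj D s`_i.+1 s`_i, adj D s`_i.+1 s`_i.+2 & s`_i <> s`_i.+2].
Proof.
move=> sss si; split; [exact/adj_sym/strand_adj/ltnW|exact: strand_adj|].
move=> e; have [|_ /n_Sn //] := strand_edge_unique sss sss (ltnW si) si.
by right.
Qed.

(** The ends of the strands are pairwise distinct and not interior to the disc,
    so no strand comes back to the end of one. *)
Lemma end_inside_unique s u a b : s \in ss -> u \in path_ends s ->
  inside ss u a -> inside ss u b -> a = b.
Proof.
move=> sss us.
have [U U'] := uniq_flatten_map (tangle_uniq_ends T).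
have ends c : inside ss u c -> (u = s`_0 /\ c = s`_1) \/
    (u = s`_(size s).-1 /\ c = s`_(size s).-2).
  move=> [t tss /path_edgesP[j tj ucE]].
  have uNint := end_not_interior sss us.
  have ts : u \in path_ends t -> t = s.
    by move=> ut; exact: (U' t s tss sss u).
  case: ucE => -[uE cE].
    case: j => [|j] in tj uE cE *.
      by left; rewrite -ts // uE; exact: head_end.
    by case: uNint; rewrite uE; exact: (tangle_interior T).
  have [tj'|tj'] := ltnP j.+2 (size t).
    by case: uNint; rewrite uE; exact: (tangle_interior T).
  have jE : (size t).-1 = j.+1 by rewrite (@anti_leq (size t) j.+2) ?tj'.
  right; rewrite -ts; first by rewrite jE.
  by rewrite uE -jE; exact: last_end.
have NhL : s`_0 <> s`_(size s).-1.
  move: (U s sss); rewrite /path_ends /= inE andbT nth0 nth_last.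
  by move/eqP.
by move=> /ends[[ua ->]|[ua ->]] /ends[[ub ->]|[ub ->]] //;
  case: NhL; rewrite -ua -ub.
Qed.

(** The second edge at an end lies outside, where a move changes nothing; it
    carries the color of the end over to the other diagram. *)
Lemma end_outside s u : s \in ss -> u \in path_ends s ->
  exists2 a, adj D u a & ~ inside ss u a.
Proof.
move=> sss us; have [[a [b [ab uE]]] _ _] := tangle_ends T sss us.
have [ua|] := pselect (inside ss u a); last by exists a => //; apply/uE; left.
exists b; first by apply/uE; right.
by move=> ub; apply: ab; exact: end_inside_unique sss us ua ub.
Qed.

(** Two passages through a crossing that are both over or both under run along
    the same two opposite edges, and no edge is used twice. *)
Lemma gauss_codes_uniq : uniq (flatten [seq gauss_code D s | s <- ss]).
Proof.
pose f (p : (R * R) * (R * R)) := (p.1, `[< over D p.1 p.2 >]).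
pose P (p : (R * R) * (R * R)) := `[< crossing (adj D) p.1 >].
pose E s := zip s (behead s).
have -> : flatten [seq gauss_code D s | s <- ss] =
    map f (seq.filter P (flatten [seq E s | s <- ss])).
  rewrite filter_flatten map_flatten -!map_comp.
  by congr flatten; apply: eq_map => s /=; exact: gauss_codeE.
have [U U'] := uniq_flatten_map (tangle_uniq_edges T).
have EP p : p \in flatten [seq E s | s <- ss] ->
    exists s i, [/\ s \in ss, (i.+1 < size s)%N & p = (s`_i, s`_i.+1)].
  move=> /flatten_mapP[s sss /(nthP (0, 0))[i]].
  rewrite (size_edges s).1 => si <-; have {}si : (i.+1 < size s)%N by case: (size s) si.
  by exists s, i; rewrite (nth_edges si).1.
rewrite map_inj_in_uniq; last first.
  move=> [x a] [y b]; rewrite !mem_filter => /andP[/asboolP /= cx xa] /andP[_ yb].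
  rewrite /f /= => -[yx oab]; subst y.
  have [s [i [sss si [xs as_]]]] := EP _ xa.
  have [t [j [tss tj [xt bt]]]] := EP _ yb.
  have [xa' xb'] : adj D x a /\ adj D x b.
    by split; [rewrite xs as_|rewrite xt bt]; exact: strand_adj.
  have oE : over D x a <-> over D x b.
    by split=> /asboolP; [rewrite oab|rewrite -oab]; move/asboolP.
  have [->//|abx] := (over_strand cx xa' xb').1 oE.
  case: i => [|i] in si xs as_ *.
    have [jx _ _] := tangle_ends T sss (head_end sss).
    by case: (joint_crossing jx); rewrite -xs.
  have [xc _ _] := visit_neighbors sss si.
  have bE : b = s`_i.
    apply: (opposite_unique (a := a) xb' _ abx); rewrite xs //.
    by apply/open_segmentC; rewrite as_; apply: strand_straight; rewrite -?xs.
  have [|st ij] := strand_edge_unique sss tss (ltnW si) tj.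
    by right; rewrite -xt -xs -bt -bE.
  by case: (@adj_irrefl _ D x); rewrite {2}xt -st -ij -bE.
apply: filter_uniq; elim: (ss) (tangle_uniq_edges T) => //= s r IH.
rewrite !cat_uniq => /and3P[/andP[Us _] /hasPn disj /IH ->]; rewrite Us andbT /=.
apply/hasPn => e /flatten_mapP[t tr et].
have /disj : e \in flatten [seq path_edges s | s <- r].
  by apply/flatten_mapP; exists t => //; rewrite mem_cat et.
by rewrite mem_cat negb_or => /andP[].
Qed.

End Tangles.

(** * Colorings of tangles *)

(** One function gives both the colors of the crossings, as used in
    [code_coloring], and the colors at the ends of strands, which are joints. *)
Definition vertex_colors (R : realType) (X : quandle) (D : diagram R)
    (h : R * R -> R * R -> X) (kappa : R * R -> X) : Prop :=
  (forall x a, over D x a -> h x a = kappa x) /\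
  (forall x a, joint (adj D) x -> adj D x a -> h x a = kappa x).

Lemma vertex_colors_exist (R : realType) (X : quandle) (D : diagram R)
    (h : R * R -> R * R -> X) :
  half_edge_coloring D h -> exists kappa, vertex_colors D h kappa.
Proof.
move=> H; pose P x := [set a | over D x a \/ joint (adj D) x /\ adj D x a].
exists (fun x => h x (xget x (P x))); split=> x a.
  move=> xa; have [xb|[jx _]] : P x (xget x (P x)) by apply: xgetPex; exists a; left.
    exact: (vertex_over (half_edge_vertex H x)).
  by case: (joint_crossing jx); have [] := over_crossing xa.
move=> jx xa; have nx := (jointE xa).1 jx.
have [/nx //|[_ xb]] : P x (xget x (P x)) by apply: xgetPex; exists a; right.
exact: (vertex_joint (half_edge_vertex H x)).
Qed.

Definition end_colors (R : realType) (X : quandle) (kappa : R * R -> X)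
    (s : seq (R * R)) : X * X := (kappa (head 0 s), kappa (last 0 s)).

(** The indices are those of the sequence in [gauss_code_coloringP]. *)
Definition strand_color (R : realType) (X : quandle) (h : R * R -> R * R -> X)
    (kappa : R * R -> X) (s : seq (R * R)) (i : nat) : X :=
  if i is j.+1 then h s`_j s`_j.+1 else kappa s`_0.

Section TangleColorings.
Variables (R : realType) (X : quandle) (D : diagram R) (B : set (R * R)).
Variable ss : seq (seq (R * R)).
Hypothesis T : tangle D B ss.
Implicit Types (s : seq (R * R)) (u v x a b : (R * R)%type).
Implicit Types (h : R * R -> R * R -> X) (kappa : R * R -> X).

Lemma strand_passes h kappa s i : half_edge_coloring D h ->
  vertex_colors D h kappa -> s \in ss -> (i.+1 < size s)%N ->
  passes D kappa s`_i s`_i.+1 (strand_color h kappa s i)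
    (strand_color h kappa s i.+1).
Proof.
move=> H [overK jointK] sss; rewrite /passes; case: i => [|i] si /=.
  have [j0 _ _] := tangle_ends T sss (head_end sss).
  rewrite asboolF; first by apply: jointK => //; exact: (strand_adj T sss si).
  exact: joint_crossing j0.
have [xa xb _] := visit_neighbors T sss si.
rewrite -(half_edge_sym H xa).
case: asboolP => [cx|ncx]; last first.
  by have [jx|//] := adj_valency xa; rewrite !jointK.
have abx := strand_straight T sss si cx.
case: asboolP => [ob|nob].
  by rewrite !overK //; apply/(over_opposite cx xa xb abx).
have [c xc] := crossing_over cx.
rewrite -(overK _ _ xc); apply: (vertex_under (half_edge_vertex H _)) => //.
by move/(over_opposite cx xa xb abx).
Qed.

Lemma strand_color_last h kappa s : half_edge_coloring D h ->
  vertex_colors D h kappa -> s \in ss ->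
  strand_color h kappa s (size s).-1 = kappa s`_(size s).-1.
Proof.
move=> H [_ jointK] sss; have [jl _ _] := tangle_ends T sss (last_end sss).
case E : (size s) (strand_size T sss) jl => [|[|n]] //= _ jl.
have xa : adj D s`_n s`_n.+1 by apply: (strand_adj T); rewrite ?E.
by rewrite (half_edge_sym H xa) jointK //; exact: adj_sym.
Qed.

Lemma tangle_codes_coloring h kappa : half_edge_coloring D h ->
  vertex_colors D h kappa ->
  codes_coloring kappa [seq gauss_code D s | s <- ss]
    [seq end_colors kappa s | s <- ss].
Proof.
move=> H K; apply/codes_coloring_map => s sss; apply/gauss_code_coloringP.
exists (strand_color h kappa s); split=> /=; first by rewrite nth0.
  by move=> i; exact: strand_passes.
by rewrite strand_color_last // nth_last.
Qed.

(** The colors outside the disc give those at the ends of the strands, hence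
    those of the crossings by [codes_coloring_determined], hence the colors
    along the strands, one edge after the other. *)
Lemma tangle_rigid cds h1 h2 :
  move_pattern [seq gauss_code D s | s <- ss] cds \/
    move_pattern cds [seq gauss_code D s | s <- ss] ->
  half_edge_coloring D h1 -> half_edge_coloring D h2 ->
  (forall u v, adj D u v -> ~ inside ss u v -> h1 u v = h2 u v) ->
  forall u v, adj D u v -> h1 u v = h2 u v.
Proof.
move=> P H1 H2 out u v uv.
have [kappa1 K1] := vertex_colors_exist H1.
have [kappa2 K2] := vertex_colors_exist H2.
have endE s x : s \in ss -> x \in path_ends s -> kappa1 x = kappa2 x.
  move=> sss xs; have [jx _ _] := tangle_ends T sss xs.
  have [a xa nxa] := end_outside T sss xs.
  by rewrite -(K1.2 _ _ jx xa) -(K2.2 _ _ jx xa) out.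
have endsE : [seq end_colors kappa1 s | s <- ss] =
    [seq end_colors kappa2 s | s <- ss].
  apply/eq_in_map => s sss; rewrite /end_colors.
  by congr pair; apply: (endE s) => //; rewrite !inE eqxx ?orbT.
have C1 := tangle_codes_coloring H1 K1.
have C2 := tangle_codes_coloring H2 K2.
rewrite -endsE in C2.
have crossE := codes_coloring_determined P C1 C2.
have strandE s i : s \in ss -> (i < size s)%N ->
    strand_color h1 kappa1 s i = strand_color h2 kappa2 s i.
  move=> sss; elim: i => [|i IH] si; first exact: endE (head_end sss).
  have p1 := strand_passes H1 K1 sss si; have p2 := strand_passes H2 K2 sss si.
  rewrite -(IH (ltnW si)) in p2; apply: passes_inj p1 p2 => cx; apply: crossE.
  have /mapP[q q1 ->] := mem_gauss_code si cx.
  by apply: map_f; apply/flatten_mapP; exists s.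
have [[s sss /path_edgesP[i si uvE]]|] := pselect (inside ss u v); last exact: out.
have e : h1 s`_i s`_i.+1 = h2 s`_i s`_i.+1 := strandE s i.+1 sss si.
case: uvE => -[uE vE]; rewrite ?uE ?vE //.
have xa := strand_adj T sss si.
by rewrite -(half_edge_sym H1 xa) -(half_edge_sym H2 xa).
Qed.

End TangleColorings.

(** * Replacing the tangle in a disc *)

(** An edge outside the disc has a point off the disc and so belongs to both
    diagrams, and edges inside the disc have none. *)
Lemma outside_edge (R : realType) (D D' : diagram R) B ss ss' (u v : R * R) :
  tangle D B ss -> tangle D' B ss' ->
  (forall u v, ~ (open_segment u v `<=` interior B) ->
     (adj D u v <-> adj D' u v)) ->
  adj D u v -> ~ inside ss u v -> adj D' u v /\ ~ inside ss' u v.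
Proof.
move=> T T' adj_off uv nuv.
have nsub : ~ (open_segment u v `<=` interior B).
  move=> sub; have [w wuv] := open_segment_nonempty u v.
  exact: (outside_off T uv nuv wuv (interior_subset (sub _ wuv))).
by split=> [|/(inside_interior T') //]; apply/adj_off.
Qed.

Section Replacement.
Variables (R : realType) (X : quandle) (D D' : diagram R) (B : set (R * R)).
Variables ss ss' : seq (seq (R * R)).
Hypothesis T : tangle D B ss.
Hypothesis T' : tangle D' B ss'.
Hypothesis adj_off : forall u v, ~ (open_segment u v `<=` interior B) ->
  (adj D u v <-> adj D' u v).
Hypothesis over_off : forall u v, ~ B u -> (over D u v <-> over D' u v).
Hypothesis endsE : [seq path_ends s | s <- ss] = [seq path_ends s | s <- ss'].
Implicit Types (s : seq (R * R)) (u v x a b w : (R * R)%type).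
Implicit Types (h : R * R -> R * R -> X) (kappa : R * R -> X).

Let outD' u v : adj D' u v -> ~ inside ss' u v -> adj D u v /\ ~ inside ss u v.
Proof. by apply: outside_edge T' T _ => a b /adj_off ->. Qed.

Let end_colorsE kappa :
  [seq end_colors kappa s | s <- ss] = [seq end_colors kappa s | s <- ss'].
Proof.
pose f (e : seq (R * R)) := (kappa e`_0, kappa e`_1).
by have := congr1 (map f) endsE; rewrite -!map_comp.
Qed.

Let endD s u : s \in ss' -> u \in path_ends s -> joint (adj D) u.
Proof.
move=> sss us; have : path_ends s \in [seq path_ends s | s <- ss].
  by rewrite endsE; exact: map_f.
by move=> /mapP[t tss e]; have [] := tangle_ends T tss (u := u); rewrite -?e.
Qed.

(** The codes after the move are colored by [codes_coloring_move], with the same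
    colors at the ends; [gauss_code_coloringP] turns this into colors of the
    edges inside the disc, and outside the old colors are kept. *)
Lemma tangle_extend h : involutory X ->
  move_pattern [seq gauss_code D s | s <- ss] [seq gauss_code D' s | s <- ss'] \/
    move_pattern [seq gauss_code D' s | s <- ss'] [seq gauss_code D s | s <- ss] ->
  half_edge_coloring D h ->
  exists2 h', half_edge_coloring D' h' & half_edges_agree_off D D' B h h'.
Proof.
move=> inv P H.
have [kappa K] := vertex_colors_exist H.
have [omega] := codes_coloring_move inv P (gauss_codes_uniq T')
  (tangle_codes_coloring T H K).
rewrite end_colorsE => /codes_coloring_map C.
have /choice[G HG] : forall s, exists g : nat -> X, s \in ss' ->
    [/\ g 0%N = kappa s`_0,
      forall i, (i.+1 < size s)%N ->
        passes D' omega s`_i s`_i.+1 (g i) (g i.+1) &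
      g (size s).-1 = kappa s`_(size s).-1].
  move=> s.
  have [/C/gauss_code_coloringP[g] |] := boolP (s \in ss').
    by rewrite /end_colors /= -nth0 -nth_last => Hg; exists g.
  by exists (fun=> kappa 0).
(* An edge inside the disc belongs to one strand [p.1], at one index [p.2], so
   that its color can be read off from [G]. *)
pose located u v (p : seq (R * R) * nat) :=
  [/\ p.1 \in ss', (p.2.+1 < size p.1)%N & same_edge u v p.1`_p.2 p.1`_p.2.+1].
pose h' u v := if pselect (exists p, located u v p) is left L
  then let p := sval (cid L) in G p.1 p.2.+1 else h u v.
have h'in s i u v : s \in ss' -> (i.+1 < size s)%N ->
    same_edge u v s`_i s`_i.+1 -> h' u v = G s i.+1.
  move=> sss si uvE; rewrite /h'; case: pselect => [L|[]]; last by exists (s, i).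
  case: cid => -[t j] [/= tss tj tE].
  have [|-> -> //] := strand_edge_unique T' tss sss tj si.
  by case: uvE tE => -[-> ->] [[-> ->]|[-> ->]]; [left|right|right|left].
have h'out u v : ~ inside ss' u v -> h' u v = h u v.
  move=> nuv; rewrite /h'; case: pselect => // -[[s i] [sss si uvE]].
  by case: nuv; exists s => //; apply/path_edgesP; exists i.
have h'joint x a : joint (adj D) x -> adj D' x a -> ~ inside ss' x a ->
    h' x a = kappa x.
  by move=> jx xa nxa; rewrite h'out // K.2 //; have [] := outD' xa nxa.
have h'end s x a : s \in ss' -> x \in path_ends s -> adj D' x a -> h' x a = kappa x.
  move=> sss xs xa; have jx := endD sss xs.
  have [[t tss /path_edgesP[j tj xaE]]|] := pselect (inside ss' x a); last exact: h'joint.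
  rewrite (h'in _ _ _ _ tss tj xaE); have [G0 GS Glast] := HG t tss.
  have xNint := end_not_interior T' sss xs.
  case: xaE => -[xE _].
    case: j => [|j] in tj xE *.
      have [j0 _ _] := tangle_ends T' tss (head_end tss).
      have := GS 0%N tj; rewrite /passes asboolF; last exact: joint_crossing.
      by move=> ->; rewrite G0 xE.
    by case: xNint; rewrite xE; exact: (tangle_interior T').
  have [tj'|tj'] := ltnP j.+2 (size t).
    by case: xNint; rewrite xE; exact: (tangle_interior T').
  have jE : (size t).-1 = j.+1 by rewrite (@anti_leq (size t) j.+2) ?tj'.
  by rewrite -jE Glast jE xE.
have h'visit s i : s \in ss' -> (i.+2 < size s)%N ->
    [/\ h' s`_i.+1 s`_i = G s i.+1, h' s`_i.+1 s`_i.+2 = G s i.+2 &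
        passes D' omega s`_i.+1 s`_i.+2 (G s i.+1) (G s i.+2)].
  move=> sss si; have [_ GS _] := HG s sss.
  rewrite (h'in s i) //; [|exact: ltnW|by right].
  by rewrite (h'in s i.+1) //; [split=> //; exact: GS|left].
have h'over x a : interior B x -> over D' x a -> h' x a = omega x.
  move=> Bx xa; have [cx xa'] := over_crossing xa.
  have [s [i [sss si xE aE]]] := interior_visit T' Bx xa'.
  have [h1 h2] := h'visit s i sss si; have [x1 x2 _] := visit_neighbors T' sss si.
  have := strand_straight T' sss si; rewrite -xE in h1 h2 x1 x2 * => /(_ cx) x12.
  have o12 := over_opposite cx x1 x2 x12.
  rewrite /passes asboolT // asboolT.
    by case: aE => ->; [rewrite h1 => -[->]|rewrite h2 => -[-> ->]].
  by case: aE xa => -> // /o12.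
have H' : half_edge_coloring D' h'.
  split=> [u v uv|x].
    have [[s sss /path_edgesP[i si uvE]]|nuv] := pselect (inside ss' u v).
      rewrite (h'in s i u v) // (h'in s i v u) //.
      by case: uvE => -[-> ->]; [right|left].
    have nvu : ~ inside ss' v u by move=> /inside_sym.
    by rewrite !h'out //; apply: (half_edge_sym H); have [] := outD' uv nuv.
  have [Bx|nBx] := pselect (B x); last first.
    have nx a : adj D' x a -> ~ inside ss' x a by move=> _ /(inside_in T').
    apply: (@vertex_coloring_transport _ _ D D' x id (h x)).
    - move=> a xa; have [xa' _] := outD' xa (nx a xa).
      by split=> //; exact: over_off.
    - by move=> b /over_off => /(_ nBx); exists b.
    - by move=> a /nx/h'out.
    - exact: (half_edge_vertex H).
  have [[s sss xs]|nend] := pselect (exists2 s, s \in ss' & x \in path_ends s).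
    have [jx _ _] := tangle_ends T' sss xs.
    have nx v : ~ over D' x v by move=> /over_crossing[cx _]; exact: joint_crossing cx.
    split=> [a b xa xb _|a b /nx //|b a a' /nx //].
    by rewrite !(h'end s).
  (* A vertex of the disc that is not an end lies in its interior, where
     [interior_visit] and [h'visit] give the colors of all half-edges. *)
  have int a : adj D' x a -> interior B x.
    move=> xa; have [s sss xs] := tangle_vertices T' xa Bx.
    have [i si xE] : exists2 i, (i < size s)%N & x = s`_i.
      by exists (index x s); [rewrite index_mem|rewrite nth_index].
    rewrite xE; apply: (tangle_interior T') => //.
      case: i si xE => // _ xE; case: nend; exists s => //.
      by rewrite xE; exact: (head_end sss).
    rewrite ltnNge; apply/negP => si'; case: nend; exists s => //.
    have iE : i = (size s).-1 by rewrite (@anti_leq (size s) i.+1) ?si'.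
    by rewrite xE iE; exact: (last_end sss).
  split=> [a b xa xb nx|a b xa xb|b a a' xb xa xa' nxa aa'].
  - have ncx : ~ crossing (adj D') x by exact/joint_crossing/(jointE xa).
    have [c [d [cd xE]]] := (jointE xa).2 nx.
    have [s [i [sss si sE _]]] := interior_visit T' (int a xa) xa.
    have [h1 h2] := h'visit s i sss si; rewrite /passes asboolF -?sE // => G12.
    rewrite -sE in h1 h2; have [] := visit_neighbors T' sss si.
    rewrite -sE => /xE x1 /xE x2 x12.
    have hE e : adj D' x e -> h' x e = G s i.+1.
      move=> /xE eE; have [->|->] : e = s`_i \/ e = s`_i.+2; last 2 first.
      + exact: h1.
      + by rewrite h2.
      + case: eE x1 x2 x12 => -> [] -> [] -> //; by [left|right].
    by rewrite !hE.
  - have [_ xa'] := over_crossing xa.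
    by rewrite !h'over //; exact: int xa'.
  - have [cx xb'] := over_crossing xb.
    rewrite (h'over _ _ (int b xb') xb).
    have [s [i [sss si sE aE]]] := interior_visit T' (int a xa) xa.
    have [h1 h2] := h'visit s i sss si; have [x1 x2 _] := visit_neighbors T' sss si.
    have := strand_straight T' sss si; rewrite -sE in h1 h2 x1 x2 * => /(_ cx) x12.
    have o12 := over_opposite cx x1 x2 x12.
    rewrite /passes asboolT // asboolF; last first.
      by case: aE nxa => -> nxa //; move/o12.
    case: aE aa' => -> aa' Gs.
      by rewrite (opposite_unique xa' x2 aa' x12) h1 h2.
    (* The strand is read from [a'] to [a]; involutivity reverses it. *)
    rewrite (opposite_unique xa' x1 aa' (open_segmentC x12)) h1 h2 Gs.
    by rewrite inv rtriK.
exists h' => // u v u' v' w uv uv' wuv wuv' Bw.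
have nuv : ~ inside ss u v.
  by move=> /(inside_interior T)/(_ _ wuv)/interior_subset.
have nuv' : ~ inside ss' u' v'.
  by move=> /(inside_interior T')/(_ _ wuv')/interior_subset.
have [Duv' _] := outD' uv' nuv'.
rewrite h'out //.
have [[-> ->]|[-> ->]] // := embedded_edges uv Duv' wuv wuv'.
exact: (half_edge_sym H uv).
Qed.

End Replacement.

(** * The bijection of a move and the functor *)

Definition move_support (R : realType) (S : move_site R) : set (R * R) :=
  match S with Subdivide => set0 | InDisc B => B end.

Section Moves.
Variables (R : realType) (X : quandle).
Hypothesis inv : involutory X.
Implicit Types (D E F : diagram R) (h : R * R -> R * R -> X).

(** Apart from the direction of the pattern, a local move treats both sides
    alike. *)
Lemma local_move_sides B D D' : local_move B D D' \/ local_move B D' D ->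
  exists ss ss', [/\ tangle D B ss, tangle D' B ss',
    (forall u v, ~ (open_segment u v `<=` interior B) ->
      (adj D u v <-> adj D' u v)) /\
    (forall u v, ~ B u -> (over D u v <-> over D' u v)),
    [seq path_ends s | s <- ss] = [seq path_ends s | s <- ss'] &
    move_pattern [seq gauss_code D s | s <- ss]
      [seq gauss_code D' s | s <- ss'] \/
    move_pattern [seq gauss_code D' s | s <- ss']
      [seq gauss_code D s | s <- ss]].
Proof.
case=> -[adjE [overE [ss [ss' [T T' endsE P]]]]].
  by exists ss, ss'; split=> //; left.
exists ss', ss; split=> //; last by right.
by split=> u v H; [rewrite adjE|rewrite overE].
Qed.

Lemma pattern_nonempty (cds cds' : seq (seq ((R * R) * bool))) :
  move_pattern cds cds' \/ move_pattern cds' cds -> cds != [::].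
Proof. by do 2!case. Qed.

(** The edge gives a color, with which colorings become functions on all pairs
    of points, see [half_edges_of_coloring]. *)
Lemma move_has_edge S D D' : move_at S D D' \/ move_at S D' D ->
  exists u v, adj D u v.
Proof.
case: S => [|B] /=.
  case=> [[u [v [m [uv _ _ _ _]]]]|[u [v [m [_ _ adjE _ _]]]]]; first by exists u, v.
  by exists u, m; apply/adjE/Or32; left.
move=> /local_move_sides[[|s ss] [ss' [T _ _ _ /pattern_nonempty //]]] _.
have sss : s \in s :: ss by rewrite inE eqxx.
by exists s`_0, s`_1; exact: (strand_adj T sss (strand_size T sss)).
Qed.

Lemma half_edges_move S D D' h : move_at S D D' \/ move_at S D' D ->
  half_edge_coloring D h -> exists2 h', half_edge_coloring D' h' &
    half_edges_agree_off D D' (move_support S) h h'.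
Proof.
case: S => [|B] /=; last first.
  move=> /local_move_sides[ss [ss' [T T' [adjE overE] endsE P]]].
  exact: (tangle_extend T T' adjE overE endsE inv P).
case=> -[u [v [m [uv uvm adjE overE [ou ov]]]]] H.
  exact: (color_subdivision uv uvm adjE overE ou ov H).
have [h' H' hh'] := color_merge uv uvm adjE overE ou ov H.
by exists h' => // a b a' b' w ab ab' wab wab' Sw; rewrite (hh' _ _ a b w ab' ab).
Qed.

Lemma half_edges_move_unique S D D' h h1 h2 :
  move_at S D D' \/ move_at S D' D ->
  half_edge_coloring D' h1 -> half_edge_coloring D' h2 ->
  half_edges_agree_off D D' (move_support S) h h1 ->
  half_edges_agree_off D D' (move_support S) h h2 ->
  forall u v, adj D' u v -> h1 u v = h2 u v.
Proof.
move=> M H1 H2 hh1 hh2.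
have eqI u v u' v' w : adj D' u v -> adj D u' v' -> open_segment u v w ->
    open_segment u' v' w -> ~ move_support S w -> h1 u v = h2 u v.
  by move=> uv uv' wuv wuv' Sw; rewrite -(hh1 u' v' u v w) // -(hh2 u' v' u v w).
case: S M hh1 hh2 eqI => [|B] /= M _ _ eqI; last first.
  have [ss [ss' [T T' [adjE _] _ P]]] := local_move_sides M.
  apply: (tangle_rigid T' (cds := [seq gauss_code D s | s <- ss])) => //.
    by case: P; [right|left].
  move=> u v uv nuv; have [w wuv] := open_segment_nonempty u v.
  have adjE' a b : ~ (open_segment a b `<=` interior B) ->
    (adj D' a b <-> adj D a b) by move/adjE=> ->.
  have [uv' _] := outside_edge T' T adjE' uv nuv.
  by apply: (eqI u v u v w) => //; exact: (outside_off T' uv nuv wuv).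
move=> a b ab.
have [a' [b' [w [ab' wab' wab]]]] : exists a' b' w,
    [/\ adj D a' b', open_segment a' b' w & open_segment a b w].
  case: M => -[u [v [m [uv uvm adjE _ _]]]].
    exact: (subdivided_edge_covered uv uvm adjE ab).
  have [a' [b' [w [? ? ?]]]] := subdivision_edge_covered uvm adjE ab.
  by exists a', b', w.
exact: (eqI a b a' b' w ab ab').
Qed.

Lemma move_coloring D E (m : move D E) (c : coloring X D) :
  exists c' : coloring X E, agree_off (move_support (site m)) c c'.
Proof.
have [u [v /arc_at[A _]]] := move_has_edge (move_valid m).
have [h H hc] := half_edges_of_coloring (sval c A) c.
have [h' H' hh'] := half_edges_move (move_valid m) H.
have [c' hc'] := coloring_of_half_edges H'.
by exists c'; apply/(agree_offP _ hc hc').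
Qed.

Lemma move_coloring_unique D E (m : move D E) (c : coloring X D)
    (c1 c2 : coloring X E) :
  agree_off (move_support (site m)) c c1 ->
  agree_off (move_support (site m)) c c2 -> c1 = c2.
Proof.
have [u [v /arc_at[A _]]] := move_has_edge (move_valid m).
have [h H hc] := half_edges_of_coloring (sval c A) c.
have [h1 H1 hc1] := half_edges_of_coloring (sval c A) c1.
have [h2 H2 hc2] := half_edges_of_coloring (sval c A) c2.
move=> /(agree_offP _ hc hc1) a1 /(agree_offP _ hc hc2) a2.
exact: (coloring_ext hc1 hc2 (half_edges_move_unique (move_valid m) H1 H2 a1 a2)).
Qed.

Definition recolor D E (m : move D E) (c : coloring X D) : coloring X E :=
  sval (cid (move_coloring m c)).

Lemma recolorP D E (m : move D E) (c : coloring X D) :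
  agree_off (move_support (site m)) c (recolor m c).
Proof. exact: svalP (cid (move_coloring m c)). Qed.

(** [agree_off] is symmetric and a move has the support of its reverse, so
    uniqueness makes the two recolorings inverse to each other. *)
Lemma recolorK D E (m : move D E) (c : coloring X D) :
  recolor (rev_move m) (recolor m c) = c.
Proof.
apply: (move_coloring_unique (m := rev_move m)); first exact: recolorP.
exact/agree_off_sym/recolorP.
Qed.

Fixpoint recolor_moves D E (w : moves D E) : coloring X D -> coloring X E :=
  match w in moves D E return coloring X D -> coloring X E with
  | mnil _ => fun c => c
  | mcons _ _ _ m w' => fun c => recolor_moves w' (recolor m c)
  end.

Lemma recolor_moves_eq D E (w w' : moves D E) :
  moves_eq w w' -> recolor_moves w = recolor_moves w'.
Proof.
elim=> {D E w w'} [//|//|D E w w' w'' _ -> _ -> //|D E F m w w' _ IH|D E F m w].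
  by apply/funext => c /=; rewrite IH.
by apply/funext => c /=; rewrite recolorK.
Qed.

Lemma recolor_moves_cat D E F (w : moves D E) (w' : moves E F) c :
  recolor_moves (mcat w w') c = recolor_moves w' (recolor_moves w c).
Proof. by elim: w w' c => //= D1 E1 F1 m w IH w' c; rewrite IH. Qed.

End Moves.

Theorem theorem3p2 (R : realType) (X : quandle) (hX : involutory X) :
  exists F : functor (KDiag R) SetCat,
    forall K : diagram R, F K = coloring X K :> Type.
Proof.
unshelve eexists.
  refine (@Functor (KDiag R) SetCat (fun K : diagram R => coloring X K : Type)
    (fun D E (w : moves D E) => recolor_moves hX w) _ _ _) => //.
  - by move=> D E w w'; exact: recolor_moves_eq.
  - by move=> D E F w w'; apply/funext => c; exact: recolor_moves_cat.
by [].
Qed.
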